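(* Let $(S,\mathfrak n)$ be a commutative noetherian local ring and let $\omega\in\mathfrak n$ be a non-zerodivisor. Then there is an equivalence of categories $F:\mathsf{Mon}(\omega,\mathcal G)\longrightarrow\mathsf{MF}(\omega,\mathcal G)$.
   Context: All modules are finitely generated. A finitely generated $S$-module $M$ is Gorenstein projective if $\mathrm{Ext}^i_S(M,S)=0=\mathrm{Ext}^i_S(\mathrm{Hom}_S(M,S),S)$ for all $i\ge 1$ and the biduality map $M\to \mathrm{Hom}_S(\mathrm{Hom}_S(M,S),S)$ is an isomorphism; $\mathcal G(S)$ is the category of finitely generated Gorenstein projective $S$-modules. $\mathsf{Mon}(\omega,\mathcal G)$ is the category whose objects are the injective $S$-homomorphisms $(G_1\xrightarrow{f}G_0)$ with $G_1,G_0\in\mathcal G(S)$ and $\omega\,\mathrm{Coker} f=0$; a morphism $(G_1\xrightarrow{f}G_0)\to(G'_1\xrightarrow{f'}G'_0)$ is a pair $(\varphi_1,\varphi_0)$ of $S$-homomorphisms $\varphi_i:G_i\to G_i'$ with $f'\varphi_1=\varphi_0 f$. $\mathsf{MF}(\omega,\mathcal G)$ (matrix factorizations of Gorenstein projective modules) is the category whose objects are ordered pairs of $S$-homomorphisms $(g_1:G_1\to G_0,\ g_0:G_0\to G_1)$ with $G_1,G_0\in\mathcal G(S)$, $g_1g_0=\omega\cdot\mathrm{id}_{G_0}$ and $g_0g_1=\omega\cdot\mathrm{id}_{G_1}$; a morphism $(g_1,g_0)\to(g_1',g_0')$ is a pair of $S$-homomorphisms $\phi_1:G_1\to G_1'$,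 $\phi_0:G_0\to G_0'$ with $g_1'\phi_1=\phi_0g_1$ and $g_0'\phi_0=\phi_1g_0$. *)

(* Defs.v *)
From HB Require Import structures.
From mathcomp Require Import all_boot all_algebra.
From mathcomp Require Import ring_quotient generic_quotient.
From mathcomp Require Import boolp.
From mathcomp.multinomials Require Import freeg.

Set Implicit Arguments.
Unset Strict Implicit.
Unset Printing Implicit Defensive.

Import GRing.Theory.
Local Open Scope ring_scope.

Section Rings.
Variable S : comNzRingType.

(* [idealr_closed] describes proper ideals. *)
Definition maximal_ideal (n : {pred S}) : Prop :=
  idealr_closed n /\
  forall I : {pred S}, idealr_closed I -> {subset n <= I} -> {subset I <= n}.

Definition local_ring (n : {pred S}) : Prop :=
  maximal_ideal n /\ forall m : {pred S}, maximal_ideal m -> m =i n.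

Definition fg_submodule (M : lmodType S) (W : {pred M}) : Prop :=
  exists (n : nat) (e : 'I_n -> M), (forall i, e i \in W) /\
    forall x, x \in W -> exists c : 'I_n -> S, x = \sum_(i < n) c i *: e i.

Definition fin_gen (M : lmodType S) : Prop := @fg_submodule M predT.

(* The ideals of S are the submodules of the regular module S^o. *)
Definition noetherian_ring : Prop :=
  forall I : {pred S^o}, submod_closed I -> fg_submodule I.

End Rings.

Section LinearMaps.
Variable S : comNzRingType.

Lemma linear_ext (M N : lmodType S) (f g : {linear M -> N}) : f =1 g -> f = g.
Proof.
case: f => f [[f1] [f2]]; case: g => g [[g1] [g2]] /= fg.
have {}fg : f = g by apply/funext.
subst g; congr (GRing.Linear.Pack (GRing.Linear.Class _ _)).
  by congr GRing.isNmodMorphism.Axioms_; exact: Prop_irrelevance.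
by congr GRing.isScalable.Axioms_; exact: Prop_irrelevance.
Qed.

Definition lin_id (M : lmodType S) : {linear M -> M} := idfun.

Definition lin_comp (L M N : lmodType S)
  (g : {linear M -> N}) (f : {linear L -> M}) : {linear L -> N} := g \o f.

Lemma lin_comp_idl (M N : lmodType S) (f : {linear M -> N}) :
  lin_comp (lin_id N) f = f.
Proof. exact: linear_ext. Qed.

Lemma lin_comp_idr (M N : lmodType S) (f : {linear M -> N}) :
  lin_comp f (lin_id M) = f.
Proof. exact: linear_ext. Qed.

Lemma lin_compA (K L M N : lmodType S) (h : {linear M -> N})
    (g : {linear L -> M}) (f : {linear K -> L}) :
  lin_comp h (lin_comp g f) = lin_comp (lin_comp h g) f.
Proof. exact: linear_ext. Qed.

End LinearMaps.

Section HomModule.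
Variables (S : comNzRingType) (M N : lmodType S).
Implicit Types (f g h : {linear M -> N}) (a : S).

HB.instance Definition _ := gen_eqMixin {linear M -> N}.
HB.instance Definition _ := gen_choiceMixin {linear M -> N}.

Definition hom_zero : {linear M -> N} := \0.
Definition hom_opp f : {linear M -> N} := \- f.
Definition hom_add f g : {linear M -> N} := f \+ g.

Definition hom_scale a f : {linear M -> N} := a \*: f.

Let hom_addA : associative hom_add.
Proof. by move=> f g h; apply: linear_ext => x /=; rewrite addrA. Qed.
Let hom_addC : commutative hom_add.
Proof. by move=> f g; apply: linear_ext => x /=; rewrite addrC. Qed.
Let hom_add0 : left_id hom_zero hom_add.
Proof. by move=> f; apply: linear_ext => x /=; rewrite add0r. Qed.
Let hom_addN : left_inverse hom_zero hom_opp hom_add.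
Proof. by move=> f; apply: linear_ext => x /=; rewrite addNr. Qed.

HB.instance Definition _ := GRing.isZmodule.Build {linear M -> N}
  hom_addA hom_addC hom_add0 hom_addN.

Let hom_scaleA a b f : hom_scale a (hom_scale b f) = hom_scale (a * b) f.
Proof.
by apply: linear_ext => x; rewrite /= scalerA.
Qed.
Let hom_scale1 : left_id 1 hom_scale.
Proof. by move=> f; apply: linear_ext => x; rewrite /= scale1r. Qed.
Let hom_scaleDr : right_distributive hom_scale +%R.
Proof.
by move=> a f g; apply: linear_ext => x; rewrite /= scalerDr.
Qed.
Let hom_scaleDl f : {morph hom_scale^~ f : a b / a + b}.
Proof.
by move=> a b; apply: linear_ext => x; rewrite /= scalerDl.
Qed.

HB.instance Definition _ := GRing.Zmodule_isLmodule.Build S {linear M -> N}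
  hom_scaleA hom_scale1 hom_scaleDr hom_scaleDl.

End HomModule.

Section Quotient.
Variables (S : comNzRingType) (V : lmodType S) (W : {pred V}).
Hypothesis W_submod : submod_closed W.
Local Open Scope quotient_scope.

(* A copy of W that carries the closure property W_submod. *)
Definition submod_pred of submod_closed W : {pred V} := W.
Local Notation I := (submod_pred W_submod).

HB.instance Definition _ h :=
  GRing.isZmodClosed.Build V (submod_pred h) (GRing.submod_closedB h).

Let I_scale a v : v \in I -> a *: v \in I.
Proof. exact: (GRing.subsemimod_closedZ (GRing.submod_closed_semi W_submod)). Qed.

Definition quotmod := Quotient.quot I.

HB.instance Definition _ := GRing.Zmodule.on quotmod.

Definition quot_scale (a : S) (x : quotmod) : quotmod :=
  \pi_(Quotient.quot I) (a *: repr x).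

Definition quot_proj (v : V) : quotmod := \pi_(Quotient.quot I) v.

Lemma quot_projE v w : (quot_proj v = quot_proj w) <-> v - w \in W.
Proof.
rewrite /quot_proj; split=> [/eqP|vw]; first by rewrite -Quotient.idealrBE.
by apply/eqP; rewrite -Quotient.idealrBE.
Qed.

Let quot_projK x : quot_proj (repr x) = x. Proof. exact: reprK. Qed.

Let quot_projD v w : quot_proj (v + w) = quot_proj v + quot_proj w.
Proof. by rewrite /quot_proj !piE. Qed.

Lemma quot_scale_proj a v : quot_scale a (quot_proj v) = quot_proj (a *: v).
Proof.
apply/quot_projE; rewrite -scalerBr; apply: I_scale.
by apply/quot_projE; rewrite quot_projK.
Qed.

Let quot_scaleA a b x : quot_scale a (quot_scale b x) = quot_scale (a * b) x.
Proof. by rewrite -[x]quot_projK !quot_scale_proj scalerA. Qed.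
Let quot_scale1 : left_id 1 quot_scale.
Proof. by move=> x; rewrite -[x]quot_projK quot_scale_proj scale1r. Qed.
Let quot_scaleDr : right_distributive quot_scale +%R.
Proof.
move=> a x y; rewrite -[x]quot_projK -[y]quot_projK -quot_projD.
by rewrite !quot_scale_proj scalerDr quot_projD.
Qed.
Let quot_scaleDl x : {morph quot_scale^~ x : a b / a + b}.
Proof.
by move=> a b; rewrite -[x]quot_projK !quot_scale_proj scalerDl quot_projD.
Qed.

HB.instance Definition _ := GRing.Zmodule_isLmodule.Build S quotmod
  quot_scaleA quot_scale1 quot_scaleDr quot_scaleDl.

End Quotient.

Section KernelCokernel.
Variables (S : comNzRingType) (V U : lmodType S) (f : {linear V -> U}).

Definition in_ker : {pred V} := fun x => f x == 0.
Definition in_im : {pred U} := fun y => `[< exists x, f x = y >].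

Lemma in_ker_submod : submod_closed in_ker.
Proof.
split=> [|a x y]; rewrite !unfold_in /in_ker ?linear0 //.
by move=> /eqP fx /eqP fy; rewrite linearP fx fy scaler0 addr0.
Qed.

Lemma in_im_submod : submod_closed in_im.
Proof.
split=> [|a y z]; rewrite !unfold_in; first by apply/asboolP; exists 0; rewrite linear0.
move=> /asboolP[x <-] /asboolP[x' <-].
by apply/asboolP; exists (a *: x + x'); rewrite linearP.
Qed.

HB.instance Definition _ :=
  GRing.isSubmodClosed.Build S V in_ker in_ker_submod.

Record ker := Ker { ker_val : V; _ : ker_val \in in_ker }.

HB.instance Definition _ := [isSub for ker_val].
HB.instance Definition _ := [Choice of ker by <:].
HB.instance Definition _ := [SubChoice_isSubLmodule of ker by <:].

Definition coker : lmodType S := quotmod in_im_submod.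

End KernelCokernel.

Section Ext.
Variable S : comNzRingType.

Section FreeCover.
Variable M : lmodType S.

Definition free_cover_fun : {freeg M / S} -> M := fglift idfun.

Lemma free_cover_linear : linear free_cover_fun.
Proof.
have fcB : {morph free_cover_fun : x y / x - y} by exact: lift_is_additive.
have fc0 : free_cover_fun 0 = 0 by rewrite -[X in free_cover_fun X](subrr 0) fcB subrr.
have fcD : {morph free_cover_fun : x y / x + y}.
  by move=> x y; rewrite -[y in LHS]opprK -[- y]add0r !fcB fc0 sub0r opprK.
move=> a u v; rewrite fcD; congr (_ + _).
rewrite -[u in RHS]freeg_sumE -[a *: u]/(fgscale a u) /fgscale.
rewrite !(big_morph _ fcD fc0) scaler_sumr.
by apply: eq_bigr => x _; rewrite /free_cover_fun !liftU scalerA.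
Qed.

HB.instance Definition _ :=
  GRing.isLinear.Build S {freeg M / S} M _ free_cover_fun free_cover_linear.

Definition free_cover : {linear {freeg M / S} -> M} := free_cover_fun.

End FreeCover.

(* The free resolution
     ... -> {freeg (syzygy M 1) / S} -> {freeg (syzygy M 0) / S} -> M -> 0
   in which each module is free on the underlying set of the preceding kernel.
   Ext is independent of the projective resolution used to compute it. *)
Fixpoint syzygy (M : lmodType S) (n : nat) : lmodType S :=
  if n is n'.+1 then ker (free_cover (syzygy M n')) else M.

Definition res (M : lmodType S) (n : nat) : lmodType S :=
  {freeg (syzygy M n) / S}.

Definition res_diff (M : lmodType S) (n : nat) : {linear res M n.+1 -> res M n} :=
  lin_comp (\val : {linear ker (free_cover (syzygy M n)) -> res M n})
           (free_cover (syzygy M n.+1)).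

Section Cohomology.
Variables (M N : lmodType S).

Definition codiff_fun n (f : {linear res M n -> N}) : {linear res M n.+1 -> N} :=
  lin_comp f (res_diff M n).

Lemma codiff_linear n : linear (@codiff_fun n).
Proof. by move=> a f g; apply: linear_ext. Qed.

HB.instance Definition _ n := GRing.isLinear.Build S
  {linear res M n -> N} {linear res M n.+1 -> N} _ (@codiff_fun n)
  (@codiff_linear n).

Definition codiff n : {linear {linear res M n -> N} -> {linear res M n.+1 -> N}} :=
  @codiff_fun n.

Definition cocycle n : lmodType S := ker (codiff n).

Definition coboundary n : {pred cocycle n} :=
  match n with
  | 0 => fun z => z == 0
  | m.+1 => fun z => `[< exists f, codiff m f = \val z >]
  end.

Lemma coboundary_submod n : submod_closed (@coboundary n).
Proof.
case: n => [|n]; split=> [|a y z]; rewrite !unfold_in /coboundary ?eqxx //.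
- by move=> /eqP -> /eqP ->; rewrite scaler0 addr0.
- by apply/asboolP; exists 0; rewrite linear0.
move=> /asboolP[f fy] /asboolP[g gz].
by apply/asboolP; exists (a *: f + g); rewrite linearP fy gz.
Qed.

Definition Ext n : lmodType S := quotmod (@coboundary_submod n).

End Cohomology.
End Ext.

Definition zero_module (S : comNzRingType) (M : lmodType S) : Prop :=
  forall x : M, x = 0.

Section GorensteinProjective.
Variable S : comNzRingType.

Definition dual (M : lmodType S) : lmodType S := {linear M -> S^o}.

Definition evaluation (M : lmodType S) (x : M) (f : dual M) : S^o :=
  (f : {linear M -> S^o}) x.

Lemma evaluation_linear (M : lmodType S) (x : M) : linear (evaluation x).
Proof. by []. Qed.

HB.instance Definition _ (M : lmodType S) (x : M) :=
  GRing.isLinear.Build S (dual M) S^o _ (evaluation x) (evaluation_linear x).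

Definition biduality_fun (M : lmodType S) (x : M) : dual (dual M) :=
  (evaluation x : {linear dual M -> S^o}).

Lemma biduality_linear (M : lmodType S) : linear (@biduality_fun M).
Proof. by move=> a x y; apply: linear_ext => f; rewrite /= /evaluation linearP. Qed.

HB.instance Definition _ (M : lmodType S) :=
  GRing.isLinear.Build S M (dual (dual M)) _ (@biduality_fun M)
    (@biduality_linear M).

Definition biduality (M : lmodType S) : {linear M -> dual (dual M)} :=
  @biduality_fun M.

Definition gorenstein_projective (M : lmodType S) : Prop :=
  [/\ fin_gen M,
      forall i : nat, (1 <= i)%N -> zero_module (Ext M S^o i),
      forall i : nat, (1 <= i)%N -> zero_module (Ext (dual M) S^o i) &
      bijective (biduality M)].

End GorensteinProjective.

Record category := Category {
  obj :> Type;
  mor : obj -> obj -> Type;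
  idm : forall X, mor X X;
  comp : forall X Y Z, mor Y Z -> mor X Y -> mor X Z;
  comp_idl : forall X Y (f : mor X Y), comp (idm Y) f = f;
  comp_idr : forall X Y (f : mor X Y), comp f (idm X) = f;
  compA : forall X Y Z T (h : mor Z T) (g : mor Y Z) (f : mor X Y),
    comp h (comp g f) = comp (comp h g) f
}.

Record functor (C D : category) := Functor {
  fobj :> C -> D;
  fmor : forall X Y : C, mor X Y -> mor (fobj X) (fobj Y);
  fmor_id : forall X : C, fmor (idm X) = idm (fobj X);
  fmor_comp : forall (X Y Z : C) (g : mor Y Z) (f : mor X Y),
    fmor (comp g f) = comp (fmor g) (fmor f)
}.

Definition functor_id (C : category) : functor C C :=
  @Functor C C (fun X => X) (fun _ _ f => f) (fun _ => erefl)
    (fun _ _ _ _ _ => erefl).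

Definition functor_comp (C D E : category) (G : functor D E) (F : functor C D) :
  functor C E.
Proof.
refine (@Functor C E (fun X => G (F X)) (fun _ _ f => fmor G (fmor F f)) _ _).
- by move=> X; rewrite !fmor_id.
- by move=> X Y Z g f; rewrite !fmor_comp.
Defined.

Definition is_iso (C : category) (X Y : C) (f : mor X Y) : Prop :=
  exists g : mor Y X, comp g f = idm X /\ comp f g = idm Y.

Definition naturally_isomorphic (C D : category) (F G : functor C D) : Prop :=
  exists eta : forall X : C, mor (F X) (G X),
    (forall (X Y : C) (f : mor X Y),
       comp (fmor G f) (eta X) = comp (eta Y) (fmor F f)) /\
    (forall X : C, is_iso (eta X)).

Definition is_equivalence (C D : category) (F : functor C D) : Prop :=
  exists G : functor D C,
    naturally_isomorphic (functor_comp G F) (functor_id C) /\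
    naturally_isomorphic (functor_comp F G) (functor_id D).

Section Mon.
Variables (S : comNzRingType) (w : S).

Record mon_obj := MonObj {
  mon1 : lmodType S;
  mon0 : lmodType S;
  mon_map : {linear mon1 -> mon0};
  mon1_gp : gorenstein_projective mon1;
  mon0_gp : gorenstein_projective mon0;
  mon_inj : injective mon_map;
  mon_coker : forall c : coker mon_map, w *: c = 0
}.

Record mon_mor (X Y : mon_obj) := MonMor {
  mon_mor1 : {linear mon1 X -> mon1 Y};
  mon_mor0 : {linear mon0 X -> mon0 Y};
  mon_mor_comm : lin_comp (mon_map Y) mon_mor1 = lin_comp mon_mor0 (mon_map X)
}.

Lemma mon_mor_ext X Y (f g : mon_mor X Y) :
  mon_mor1 f = mon_mor1 g -> mon_mor0 f = mon_mor0 g -> f = g.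
Proof.
case: f g => [f1 f0 cf] [g1 g0 cg] /= e1 e0; subst g1 g0.
by congr MonMor; exact: Prop_irrelevance.
Qed.

Definition mon_idm X : mon_mor X X.
Proof.
by refine (@MonMor X X (lin_id _) (lin_id _) _); rewrite lin_comp_idl lin_comp_idr.
Defined.

Definition mon_comp X Y Z (g : mon_mor Y Z) (f : mon_mor X Y) : mon_mor X Z.
Proof.
refine (@MonMor X Z (lin_comp (mon_mor1 g) (mon_mor1 f))
                    (lin_comp (mon_mor0 g) (mon_mor0 f)) _).
by rewrite lin_compA mon_mor_comm -lin_compA mon_mor_comm lin_compA.
Defined.

Definition Mon : category.
Proof.
refine (@Category mon_obj mon_mor mon_idm mon_comp _ _ _);
  by move=> *; apply: mon_mor_ext; apply: linear_ext.
Defined.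

End Mon.

Section MF.
Variables (S : comNzRingType) (w : S).

Record mf_obj := MFObj {
  mf1 : lmodType S;
  mf0 : lmodType S;
  mf_map1 : {linear mf1 -> mf0};
  mf_map0 : {linear mf0 -> mf1};
  mf1_gp : gorenstein_projective mf1;
  mf0_gp : gorenstein_projective mf0;
  mf_mul10 : lin_comp mf_map1 mf_map0 = w *: lin_id mf0;
  mf_mul01 : lin_comp mf_map0 mf_map1 = w *: lin_id mf1
}.

Record mf_mor (X Y : mf_obj) := MFMor {
  mf_mor1 : {linear mf1 X -> mf1 Y};
  mf_mor0 : {linear mf0 X -> mf0 Y};
  mf_mor_comm1 : lin_comp (mf_map1 Y) mf_mor1 = lin_comp mf_mor0 (mf_map1 X);
  mf_mor_comm0 : lin_comp (mf_map0 Y) mf_mor0 = lin_comp mf_mor1 (mf_map0 X)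
}.

Lemma mf_mor_ext X Y (f g : mf_mor X Y) :
  mf_mor1 f = mf_mor1 g -> mf_mor0 f = mf_mor0 g -> f = g.
Proof.
case: f g => [f1 f0 cf1 cf0] [g1 g0 cg1 cg0] /= e1 e0; subst g1 g0.
by congr MFMor; exact: Prop_irrelevance.
Qed.

Definition mf_idm X : mf_mor X X.
Proof.
by refine (@MFMor X X (lin_id _) (lin_id _) _ _);
  rewrite lin_comp_idl lin_comp_idr.
Defined.

Definition mf_comp X Y Z (g : mf_mor Y Z) (f : mf_mor X Y) : mf_mor X Z.
Proof.
refine (@MFMor X Z (lin_comp (mf_mor1 g) (mf_mor1 f))
                   (lin_comp (mf_mor0 g) (mf_mor0 f)) _ _).
- by rewrite lin_compA mf_mor_comm1 -lin_compA mf_mor_comm1 lin_compA.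
- by rewrite lin_compA mf_mor_comm0 -lin_compA mf_mor_comm0 lin_compA.
Defined.

Definition MF : category.
Proof.
refine (@Category mf_obj mf_mor mf_idm mf_comp _ _ _);
  by move=> *; apply: mf_mor_ext; apply: linear_ext.
Defined.

End MF.

(* Main.v *)
(** An injective [f : G1 -> G0] whose cokernel is killed by [w] divides
    multiplication by [w] on [G0]: there is a unique [g] with [f g = w], and
    cancelling [f] in [f g f = f w] gives [g f = w]. Conversely [w] is a
    non-zerodivisor on every Gorenstein projective module, since such a module
    embeds in its bidual; hence both maps of a matrix factorization are
    injective, and forgetting the second one inverts the construction. *)

From HB Require Import structures.
Require Import Defs.
From mathcomp Require Import all_boot all_algebra.
From mathcomp Require Import generic_quotient boolp.

Set Implicit Arguments.
Unset Strict Implicit.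
Unset Printing Implicit Defensive.

Import GRing.Theory.
Local Open Scope ring_scope.

(** Used to check each identity about cofactors after composing with an injective map, where both
    sides become multiples by [w]. *)
Lemma lin_comp_monic (S : comNzRingType) (L M N : lmodType S)
    (f : {linear M -> N}) (g h : {linear L -> M}) :
  injective f -> lin_comp f g = lin_comp f h -> g = h.
Proof.
move=> f_inj fgh; apply: linear_ext => x; apply: f_inj.
by have /= -> := congr1 (fun k : {linear L -> N} => k x) fgh.
Qed.

Lemma lin_comp_idC (S : comNzRingType) (M N : lmodType S)
    (f : {linear M -> N}) : lin_comp f (lin_id M) = lin_comp (lin_id N) f.
Proof. exact: linear_ext. Qed.

Lemma killed_coker_in_im (S : comNzRingType) (w : S) (M N : lmodType S)
    (f : {linear M -> N}) :
  (forall c : coker f, w *: c = 0) -> forall y, exists x, f x = w *: y.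
Proof.
move=> wcoker y.
have /quot_projE : quot_proj (in_im_submod f) (w *: y) =
                   quot_proj (in_im_submod f) 0.
  by rewrite -quot_scale_proj [LHS]wcoker /quot_proj piE.
by rewrite subr0 => /asboolP.
Qed.

Lemma coker_killed (S : comNzRingType) (w : S) (M N : lmodType S)
    (f : {linear M -> N}) :
  (forall y, exists x, f x = w *: y) -> forall c : coker f, w *: c = 0.
Proof.
move=> wim c.
rewrite -[RHS](_ : quot_proj (in_im_submod f) 0 = 0); last by rewrite /quot_proj piE.
(* By definition of the scalar action, [w *: c] is the class of [w *: repr c], so it suffices that
   [w *: repr c] lies in the image of [f]. *)
by apply/quot_projE; rewrite subr0; apply/asboolP; apply: wim.
Qed.

Lemma lift_scale_ex (S : comNzRingType) (w : S) (M N : lmodType S)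
    (f : {linear M -> N}) :
  injective f -> (forall y, exists x, f x = w *: y) ->
  exists g : {linear N -> M}, lin_comp f g = w *: lin_id N.
Proof.
move=> f_inj wim.
pose g y := sval (cid (wim y)).
have fg y : f (g y) = w *: y := svalP (cid (wim y)).
(* The preimages are chosen pointwise; injectivity of [f] makes them unique, which forces [g] to be
   linear. *)
have g_lin : linear g.
  move=> a y z; apply: f_inj; rewrite linearP !fg scalerDr !scalerA.
  by rewrite (mulrC w).
pose gL := GRing.isLinear.Build S N M _ g g_lin.
pose g' : {linear N -> M} := HB.pack g gL.
by exists g'; apply: linear_ext => y; rewrite /= fg.
Qed.

(* Linear forms separate the points of [M], and [w] is regular on [S]. *)
Lemma gorenstein_projective_torsionfree (S : comNzRingType) (w : S)
    (M : lmodType S) :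
  gorenstein_projective M -> GRing.lreg w -> forall x : M, w *: x = 0 -> x = 0.
Proof.
move=> [_ _ _ /bij_inj bi_inj] w_reg x wx0.
apply: bi_inj; apply: linear_ext => h /=; apply: w_reg.
rewrite /biduality_fun /= /evaluation linear0 mulr0.
have hZ : (h : {linear M -> S^o}) (w *: x) = w *: h x := linearZ_LR _ _ _.
by rewrite -[LHS]hZ wx0 linear0.
Qed.

Section MonMFEquivalence.
Variables (S : comNzRingType) (w : S).

Section Cofactor.
Variable X : mon_obj w.

Let cofactor_ex : exists g, lin_comp (mon_map X) g = w *: lin_id (mon0 X).
Proof.
exact: lift_scale_ex (@mon_inj _ _ X) (killed_coker_in_im (@mon_coker _ _ X)).
Qed.

Definition mon_cofactor : {linear mon0 X -> mon1 X} := sval (cid cofactor_ex).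

Lemma mon_cofactor_r : lin_comp (mon_map X) mon_cofactor = w *: lin_id _.
Proof. exact: svalP (cid cofactor_ex). Qed.

Lemma mon_cofactor_l : lin_comp mon_cofactor (mon_map X) = w *: lin_id _.
Proof.
apply: lin_comp_monic (@mon_inj _ _ X) _.
rewrite lin_compA mon_cofactor_r.
by apply: linear_ext => x; rewrite /= linearZ.
Qed.

Definition mf_of_mon : mf_obj w :=
  MFObj (mon1_gp X) (mon0_gp X) mon_cofactor_r mon_cofactor_l.

End Cofactor.

(** This is the second square that a morphism of factorizations needs. After composition with
    [mon_map Y], both sides equal [w *: mon_mor0 f]. *)
Lemma mon_cofactor_natural (X Y : mon_obj w) (f : mon_mor X Y) :
  lin_comp (mon_cofactor Y) (mon_mor0 f) = lin_comp (mon_mor1 f) (mon_cofactor X).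
Proof.
apply: lin_comp_monic (@mon_inj _ _ Y) _.
rewrite !lin_compA mon_mor_comm mon_cofactor_r -lin_compA mon_cofactor_r.
by apply: linear_ext => x; rewrite /= linearZ.
Qed.

Definition mf_mor_of_mon (X Y : mon_obj w) (f : mon_mor X Y) :
    mf_mor (mf_of_mon X) (mf_of_mon Y) :=
  @MFMor _ _ (mf_of_mon X) (mf_of_mon Y) (mon_mor1 f) (mon_mor0 f)
    (mon_mor_comm f) (mon_cofactor_natural f).

Definition mon_to_mf : functor (Mon w) (MF w).
Proof.
by refine (@Functor (Mon w) (MF w) mf_of_mon mf_mor_of_mon _ _);
  move=> *; apply: mf_mor_ext.
Defined.

Hypothesis w_reg : GRing.lreg w.

Section Forget.
Variable Y : mf_obj w.

Lemma mf_map1_inj : injective (mf_map1 Y).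
Proof.
apply: raddf_inj => x gx0.
apply: (gorenstein_projective_torsionfree (mf1_gp Y) w_reg).
(* On the kernel of [mf_map1 Y], multiplication by [w] factors through [mf_map1 Y] and so
   vanishes. *)
have /= <- := congr1 (fun k : {linear _ -> _} => k x) (mf_mul01 Y).
by rewrite gx0 linear0.
Qed.

Lemma mf_coker_killed : forall c : coker (mf_map1 Y), w *: c = 0.
Proof.
apply: coker_killed => y; exists (mf_map0 Y y).
exact: (congr1 (fun k : {linear _ -> _} => k y) (mf_mul10 Y)).
Qed.

Definition mon_of_mf : mon_obj w :=
  MonObj (mf1_gp Y) (mf0_gp Y) mf_map1_inj mf_coker_killed.

(** The cofactor comes from a choice, so the forgotten map is recovered only through uniqueness:
    both maps compose with the injective [mf_map1 Y] to multiplication by [w]. *)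
Lemma mon_cofactor_of_mf : mon_cofactor mon_of_mf = mf_map0 Y.
Proof.
apply: lin_comp_monic mf_map1_inj _.
exact: etrans (mon_cofactor_r mon_of_mf) (esym (mf_mul10 Y)).
Qed.

End Forget.

Definition mon_mor_of_mf (X Y : mf_obj w) (f : mf_mor X Y) :
    mon_mor (mon_of_mf X) (mon_of_mf Y) :=
  @MonMor _ _ (mon_of_mf X) (mon_of_mf Y) (mf_mor1 f) (mf_mor0 f)
    (mf_mor_comm1 f).

Definition mf_to_mon : functor (MF w) (Mon w).
Proof.
by refine (@Functor (MF w) (Mon w) mon_of_mf mon_mor_of_mf _ _);
  move=> *; apply: mon_mor_ext.
Defined.

Lemma mf_to_monK :
  naturally_isomorphic (functor_comp mf_to_mon mon_to_mf) (functor_id (Mon w)).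
Proof.
(* The round trip keeps both modules and the map, so identity components give the isomorphism. *)
pose eta (X : mon_obj w) : mon_mor (mon_of_mf (mf_of_mon X)) X :=
  @MonMor _ _ (mon_of_mf (mf_of_mon X)) X
    (lin_id _) (lin_id _) (lin_comp_idC _).
pose inv (X : mon_obj w) : mon_mor X (mon_of_mf (mf_of_mon X)) :=
  @MonMor _ _ X (mon_of_mf (mf_of_mon X))
    (lin_id _) (lin_id _) (lin_comp_idC _).
exists eta; split=> [X Y f|X]; first by apply: mon_mor_ext; apply: linear_ext.
by exists (inv X); split; apply: mon_mor_ext; apply: linear_ext.
Qed.

Lemma mon_to_mfK :
  naturally_isomorphic (functor_comp mon_to_mf mf_to_mon) (functor_id (MF w)).
Proof.
(* Here the round trip replaces [mf_map0 Y] by the chosen cofactor, so the second square of an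
   identity pair requires [mon_cofactor_of_mf], in either direction. *)
have eta0 (Y : mf_obj w) : lin_comp (mf_map0 Y) (lin_id _) =
    lin_comp (lin_id _) (mon_cofactor (mon_of_mf Y)).
  by rewrite mon_cofactor_of_mf lin_comp_idC.
have inv0 (Y : mf_obj w) : lin_comp (mon_cofactor (mon_of_mf Y)) (lin_id _) =
    lin_comp (lin_id _) (mf_map0 Y).
  by rewrite mon_cofactor_of_mf lin_comp_idC.
pose eta (Y : mf_obj w) : mf_mor (mf_of_mon (mon_of_mf Y)) Y :=
  @MFMor _ _ (mf_of_mon (mon_of_mf Y)) Y
    (lin_id _) (lin_id _) (lin_comp_idC _) (eta0 Y).
pose inv (Y : mf_obj w) : mf_mor Y (mf_of_mon (mon_of_mf Y)) :=
  @MFMor _ _ Y (mf_of_mon (mon_of_mf Y))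
    (lin_id _) (lin_id _) (lin_comp_idC _) (inv0 Y).
exists eta; split=> [X Y f|Y]; first by apply: mf_mor_ext; apply: linear_ext.
by exists (inv Y); split; apply: mf_mor_ext; apply: linear_ext.
Qed.

End MonMFEquivalence.

Theorem theorem3p5 (S : comNzRingType) (n : {pred S}) (w : S)
    (S_noetherian : noetherian_ring S) (S_local : local_ring n)
    (w_in_n : w \in n) (w_nonzerodivisor : GRing.lreg w) :
  exists F : functor (Mon w) (MF w), is_equivalence F.
Proof.
exists (mon_to_mf w), (mf_to_mon w_nonzerodivisor).
by split; [exact: mf_to_monK | exact: mon_to_mfK].
Qed.
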